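(* For every closed formula $A$: $\mathsf{Kt}2\vdash A$ if and only if $\mathfrak{R}\models A$ (i.e. $v\models_{\mathfrak{R}} A$ for every world $v$) for every (uni)relational model $\mathfrak{R}$.
   Context: Formulas: $A ::= P \mid X \mid A\to B \mid \Box A \mid \blacksquare A \mid \forall X A$, with abbreviations $\bot := \forall X X$, $\neg A := A\to\bot$, $\Diamond A := \forall X(\Box(A\to\blacksquare X)\to X)$, backward diamond $\Diamond^{\bullet} A := \forall X(\blacksquare(A\to\Box X)\to X)$. $\mathsf{IKt}2$ is axiomatised by second-order intuitionistic propositional logic (including full comprehension $\forall XA\to A[C/X]$ for arbitrary $C$, modus ponens and generalisation with a fresh propositional symbol), distribution axioms $\Box(A\to B)\to\Box A\to\Box B$, $\Box(A\to B)\to\Diamond A\to\Diamond B$, $\blacksquare(A\to B)\to\blacksquare A\to\blacksquare B$, $\blacksquare(A\to B)\to\Diamond^{\bullet}A\to\Diamond^{\bullet}B$, necessitation for $\Box$ and $\blacksquare$, and tense axioms $\Diamond^{\bullet}\Box A\to A$, $A\to\Box\Diamond^{\bullet}A$, $\Diamond\blacksquare A\to A$, $A\to\blacksquare\Diamond A$. $\mathsf{Kt}2 := \mathsf{IKt}2 + (\neg\neg A\to A)$. A relational structure $\mathfrak{R}$ consists of a set $W$ of worlds, a class $\mathcal{W}\subseteq\mathcal{P}(W)$ of sets, an interpretation $P_{\mathfrak{R}}\in\mathcal{W}$ of each propositional symbol, and a relation $R\subseteq W\times W$. Satisfaction (treating each $V\in\mathcal{W}$ as a symbol interpreted by itself):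 $v\models P$ iff $v\in P_{\mathfrak{R}}$; $v\models A\to B$ iff $v\models A$ implies $v\models B$; $v\models\Box A$ iff $w\models A$ for all $vRw$; $v\models\blacksquare A$ iff $u\models A$ for all $uRv$; $v\models\forall XA$ iff $v\models A[V/X]$ for all $V\in\mathcal{W}$. A relational model is a comprehensive relational structure: for each closed formula $C$ of the expanded language, $\{w : w\models C\}\in\mathcal{W}$. *)

(* Defs.v *)
From mathcomp Require Import all_boot.
From mathcomp Require Import boolp classical_sets.

Set Implicit Arguments.
Unset Strict Implicit.
Unset Printing Implicit Defensive.

Local Open Scope classical_set_scope.

(** Second-order tense formulas over a type [S] of propositional symbols.
    Bound variables are de Bruijn indices, so formulas are taken modulo renaming
    of bound variables.  [BBox] is the backward box. *)
Inductive form (S : Type) : Type :=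
| Sym of S
| Var of nat
| Imp of form S & form S
| Box of form S
| BBox of form S
| All of form S.

Arguments Var {S} _.

Declare Scope form_scope.
Delimit Scope form_scope with F.
Bind Scope form_scope with form.
Infix "~>" := Imp (at level 55, right associativity) : form_scope.
Local Open Scope form_scope.

Section Syntax.
Variable S : Type.
Implicit Types A C : form S.

Fixpoint closed_at (k : nat) A : bool :=
  match A with
  | Sym _ => true
  | Var i => i < k
  | Imp A B => closed_at k A && closed_at k B
  | Box A | BBox A => closed_at k A
  | All A => closed_at k.+1 A
  end.

Definition closed_form A : bool := closed_at 0 A.

Fixpoint lift_at (k : nat) A : form S :=
  match A with
  | Sym s => Sym s
  | Var i => Var (if i < k then i else i.+1)
  | Imp A B => Imp (lift_at k A) (lift_at k B)
  | Box A => Box (lift_at k A)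
  | BBox A => BBox (lift_at k A)
  | All A => All (lift_at k.+1 A)
  end.

(** [lift_form A] is [A] placed under a new quantifier that does not bind in it. *)
Definition lift_form A : form S := lift_at 0 A.

Fixpoint subst_at (k : nat) C A : form S :=
  match A with
  | Sym s => Sym s
  | Var i => if i < k then Var i else if i == k then C else Var i.-1
  | Imp A B => Imp (subst_at k C A) (subst_at k C B)
  | Box A => Box (subst_at k C A)
  | BBox A => BBox (subst_at k C A)
  | All A => All (subst_at k.+1 (lift_form C) A)
  end.

(** [inst_form A C] is the capture-avoiding A[C/X], for [A] the body of [All A]. *)
Definition inst_form A C : form S := subst_at 0 C A.

Definition Bot : form S := All (Var 0).
Definition Neg A : form S := (A ~> Bot).
Definition Dia A : form S :=
  All (Box (lift_form A ~> BBox (Var 0)) ~> Var 0).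
Definition BDia A : form S :=
  All (BBox (lift_form A ~> Box (Var 0)) ~> Var 0).

End Syntax.

Arguments Bot {S}.

Fixpoint map_form (S T : Type) (f : S -> T) (A : form S) : form T :=
  match A with
  | Sym s => Sym (f s)
  | Var i => Var i
  | Imp A B => Imp (map_form f A) (map_form f B)
  | Box A => Box (map_form f A)
  | BBox A => BBox (map_form f A)
  | All A => All (map_form f A)
  end.

(** The base language has countably many propositional symbols. *)
Definition formula : Type := form nat.

Fixpoint fresh_in (P : nat) (A : formula) : bool :=
  match A with
  | Sym Q => Q != P
  | Var _ => true
  | Imp A B => fresh_in P A && fresh_in P B
  | Box A | BBox A | All A => fresh_in P A
  end.

(** [IKt2_plus T A]: [A] is derivable in IKt2 extended by the axioms in [T].
    As the only other connectives of second-order intuitionistic propositional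
    logic are the definable ones, its axioms are those for implication and the
    universal quantifier. *)
Inductive IKt2_plus (T : set formula) : formula -> Prop :=
| ax_extra A : T A -> IKt2_plus T A
| ax_K A B : IKt2_plus T (A ~> B ~> A)
| ax_S A B C : IKt2_plus T ((A ~> B ~> C) ~> (A ~> B) ~> A ~> C)
| ax_comprehension A C : IKt2_plus T (All A ~> inst_form A C)
| ax_all_imp A B : IKt2_plus T (All (lift_form A ~> B) ~> A ~> All B)
| ax_box_box A B : IKt2_plus T (Box (A ~> B) ~> Box A ~> Box B)
| ax_box_dia A B : IKt2_plus T (Box (A ~> B) ~> Dia A ~> Dia B)
| ax_bbox_bbox A B : IKt2_plus T (BBox (A ~> B) ~> BBox A ~> BBox B)
| ax_bbox_bdia A B : IKt2_plus T (BBox (A ~> B) ~> BDia A ~> BDia B)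
| ax_bdia_box A : IKt2_plus T (BDia (Box A) ~> A)
| ax_box_bdia A : IKt2_plus T (A ~> Box (BDia A))
| ax_dia_bbox A : IKt2_plus T (Dia (BBox A) ~> A)
| ax_bbox_dia A : IKt2_plus T (A ~> BBox (Dia A))
| rule_mp A B : IKt2_plus T (A ~> B) -> IKt2_plus T A -> IKt2_plus T B
| rule_gen A P : fresh_in P A -> IKt2_plus T (inst_form A (Sym P)) ->
    IKt2_plus T (All A)
| rule_nec_box A : IKt2_plus T A -> IKt2_plus T (Box A)
| rule_nec_bbox A : IKt2_plus T A -> IKt2_plus T (BBox A).

Definition IKt2 : formula -> Prop := IKt2_plus set0.

Definition Kt2 : formula -> Prop :=
  IKt2_plus (range (fun A : formula => Neg (Neg A) ~> A)).

Record relational_structure : Type := RelationalStructure {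
  world : Type;
  props : set (set world);
  symbol_interp : nat -> set world;
  symbol_interp_props : forall P, props (symbol_interp P);
  acc : world -> world -> Prop
}.

Arguments symbol_interp : clear implicits.

Section Semantics.
Variable M : relational_structure.

Definition prop_in : Type := {V : set (world M) | props V}.

(** Symbols of the language expanded by a symbol for each member of [props M]. *)
Definition esymbol : Type := (nat + prop_in)%type.

Definition esym_interp (s : esymbol) : set (world M) :=
  match s with inl P => symbol_interp M P | inr V => sval V end.

(** [sat e A v] is satisfaction at [v] of the formula obtained from [A] by
    substituting the symbols listed in [e] for its free variables; the
    substitution is delayed so that the recursion is structural.  The value at
    free variables beyond [e] is irrelevant to closed formulas. *)
Fixpoint sat (e : seq prop_in) (A : form esymbol) (v : world M) : Prop :=
  match A with
  | Sym s => esym_interp s v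
  | Var i => if onth e i is Some V then sval V v else False
  | Imp A B => sat e A v -> sat e B v
  | Box A => forall w, acc v w -> sat e A w
  | BBox A => forall u, acc u v -> sat e A u
  | All A => forall V : prop_in, sat (V :: e) A v
  end.

Definition satisfies (v : world M) (A : form esymbol) : Prop := sat [::] A v.

Lemma sat_subst (A : form esymbol) (e1 e2 : seq prop_in) (V : prop_in) v :
  sat (e1 ++ V :: e2) A v <->
  sat (e1 ++ e2) (subst_at (size e1) (Sym (inr V)) A) v.
Proof.
elim: A e1 v => [s|i|A IHA B IHB|A IHA|A IHA|A IHA] e1 v //=.
- rewrite onth_cat; case: ltngtP => [lt|gt|->] /=; rewrite ?subnn //=.
    by rewrite onth_cat lt.
  case: i gt => // i gt /=.
  by rewrite onth_cat ltnNge -ltnS gt subSn.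
- by split=> H /IHA /H /IHB.
- by split=> H w /H /IHA.
- by split=> H w /H /IHA.
- by split=> H U; apply/(IHA (U :: e1)); apply: H.
Qed.

(** Undoes the delay: quantification is over the instances A[V/X]. *)
Lemma satisfies_all (v : world M) (A : form esymbol) :
  satisfies v (All A) <->
  forall V : prop_in, satisfies v (inst_form A (Sym (inr V))).
Proof. by split=> H V; apply/(sat_subst A [::]); apply: H. Qed.

Definition comprehensive : Prop :=
  forall C : form esymbol, closed_form C -> props [set w | satisfies w C].

Definition valid_in (A : formula) : Prop :=
  forall v : world M, satisfies v (map_form inl A).

End Semantics.

Record relational_model : Type := RelationalModel {
  model_structure :> relational_structure;
  model_comprehensive : comprehensive model_structure
}.

(* Main.v *)
Require Import Defs.
From mathcomp Require Import all_boot.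
From mathcomp Require Import boolp classical_sets.

(** Completeness is a Henkin argument over the original language.  Since the
    tense axioms yield the Barcan formulas for both boxes, the theory
    [{B | Box B \in w}] of a saturated world [w] inherits the omega rule from
    [w]; hence it extends, one formula at a time, to a saturated world avoiding
    any prescribed non-member, using the symbols already present as witnesses.
    The admissible sets of the canonical model are the sets of worlds containing
    a given formula, so comprehension is an instance of the truth lemma. *)

Set Implicit Arguments.
Unset Strict Implicit.
Unset Printing Implicit Defensive.

Local Open Scope classical_set_scope.
Local Open Scope form_scope.

Definition scons (T : Type) (x : T) (r : nat -> T) (i : nat) : T :=
  if i is j.+1 then r j else x.

(** * Substitution *)

Section Substitution.
Variable S : Type.
Implicit Types A C : form S.

Lemma lift_at_lift j k A :
  j <= k -> lift_at k.+1 (lift_at j A) = lift_at j (lift_at k A).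
Proof.
elim: A j k => [s|i|A IHA B IHB|A IHA|A IHA|A IHA] j k jk //=; first last.
- by rewrite IHA.
- by rewrite IHA.
- by rewrite IHA.
- by rewrite IHA ?IHB.
congr Var; case: (ltnP i j) => ij; case: (ltnP i k) => ik /=.
- by rewrite ij ltnS (ltnW ik).
- by have:= leq_trans ij (leq_trans jk ik); rewrite ltnn.
- by rewrite ltnS ik ltnNge ij.
- by rewrite ltnS ltnNge ik /= ltnNge (leq_trans ij (leqnSn _)).
Qed.

Lemma subst_at_lift_at k C A : subst_at k C (lift_at k A) = A.
Proof.
elim: A k C => [s|i|A IHA B IHB|A IHA|A IHA|A IHA] k C //=; rewrite ?IHA ?IHB //.
case: (ltnP i k) => ik; first by rewrite ik.
by rewrite ltnNge (leq_trans ik (leqnSn _)) /= gtn_eqF.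
Qed.

Lemma inst_lift C A : inst_form (lift_form A) C = A.
Proof. exact: subst_at_lift_at. Qed.

Lemma subst_lift_at j k C A : j <= k ->
  subst_at k.+1 (lift_at j C) (lift_at j A) = lift_at j (subst_at k C A).
Proof.
elim: A j k C => [s|i|A IHA B IHB|A IHA|A IHA|A IHA] j k C jk //=;
  rewrite ?IHA ?IHB //; last by rewrite -IHA // /lift_form lift_at_lift.
case: (ltngtP i k) => ik /=.
- by case: (ltnP i j) => ij /=; rewrite ?ij ?ltnS ?ik ?(ltnW ik) // ltnNge ij.
- rewrite [i < j]ltnNge (leq_trans jk (ltnW ik)) /= ltnS ltnNge (ltnW ik) /=.
  rewrite eqSS gtn_eqF //=; case: i ik => // i; rewrite ltnS => ki /=.
  by rewrite ltnNge (leq_trans jk ki).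
- by rewrite ik [k < j]ltnNge jk /= ltnn eqxx.
Qed.

End Substitution.

Section ParallelSubstitution.
Variables S T : Type.

Definition up (r : nat -> form T) : nat -> form T :=
  scons (Var 0) (fun i => lift_form (r i)).

(** Symbols are replaced as well as indices: in the canonical model a symbol of the expanded
    language is named by a formula, which takes its place. *)
Fixpoint psubst (s : S -> form T) (r : nat -> form T) (A : form S) : form T :=
  match A with
  | Sym x => s x
  | Var i => r i
  | Imp A B => Imp (psubst s r A) (psubst s r B)
  | Box A => Box (psubst s r A)
  | BBox A => BBox (psubst s r A)
  | All A => All (psubst (fun x => lift_form (s x)) (up r) A)
  end.

Lemma subst_psubst k C s r A :
  subst_at k C (psubst s r A) =
  psubst (fun x => subst_at k C (s x)) (fun i => subst_at k C (r i)) A.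
Proof.
elim: A k C s r => [x|i|A IHA B IHB|A IHA|A IHA|A IHA] k C s r //=;
  rewrite ?IHA ?IHB //.
congr All; congr psubst; first by apply: funext => x; apply: subst_lift_at.
by apply: funext => -[|i] //=; apply: subst_lift_at.
Qed.

(** Syntactic counterpart of the quantifier clause of [den]; the [All] case of [truth] rests on
    it. *)
Lemma inst_psubst C s r A :
  inst_form (psubst (fun x => lift_form (s x)) (up r) A) C =
  psubst s (scons C r) A.
Proof.
rewrite /inst_form subst_psubst; congr psubst; apply: funext.
  by move=> x; apply: inst_lift.
by case=> [|i] //=; apply: inst_lift.
Qed.

Lemma closed_at_lift j k (A : form T) :
  closed_at k A -> closed_at k.+1 (lift_at j A).
Proof.
elim: A j k => [x|i|A IHA B IHB|A IHA|A IHA|A IHA] j k //=; auto.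
- by case: ifP => // _ ik; rewrite ltnS ltnW.
- by case/andP=> ? ?; rewrite IHA ?IHB.
Qed.

Lemma closed_psubst k s r (A : form S) :
  (forall x, closed_at k (s x)) -> (forall i, closed_at k (r i)) ->
  closed_at k (psubst s r A).
Proof.
elim: A k s r => [x|i|A IHA B IHB|A IHA|A IHA|A IHA] k s r hs hr //=; auto.
  by rewrite IHA ?IHB.
by apply: IHA => [x|[|i]] //=; apply: closed_at_lift.
Qed.

End ParallelSubstitution.

Lemma psubst_map (S S' T : Type) (f : S -> S') (s : S' -> form T) r A :
  psubst s r (map_form f A) = psubst (fun x => s (f x)) r A.
Proof.
by elim: A s r => [x|i|A IHA B IHB|A IHA|A IHA|A IHA] s r //=;
  rewrite ?IHA ?IHB.
Qed.

Lemma psubst_closed (S : Type) k r (A : form S) :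
  closed_at k A -> (forall i, i < k -> r i = Var i) -> psubst (@Sym S) r A = A.
Proof.
elim: A k r => [x|i|A IHA B IHB|A IHA|A IHA|A IHA] k r //= hA hr.
- exact: hr.
- by case/andP: hA => hA hB; rewrite (IHA k) ?(IHB k).
- by rewrite (IHA k).
- by rewrite (IHA k).
- by rewrite (IHA k.+1) // => -[|i] //= ik; rewrite hr.
Qed.

(** * Semantics with total environments *)

Section Denotation.
Variable M : relational_structure.

Section DenotationDef.
Variables (S : Type) (s : S -> set (world M)).

(** Unlike in [sat], environments are total and may hold inadmissible sets, so that the substitution
    lemmas become plain equalities of sets. *)
Fixpoint den (r : nat -> set (world M)) (A : form S) : set (world M) :=
  match A with
  | Sym x => s x
  | Var i => r i
  | Imp A B => [set v | den r A v -> den r B v]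
  | Box A => [set v | forall w, acc v w -> den r A w]
  | BBox A => [set v | forall u, acc u v -> den r A u]
  | All A => [set v | forall V : prop_in M, den (scons (sval V) r) A v]
  end.

End DenotationDef.

(** The default [set0] mirrors the value [False] that [sat] gives to indices beyond [e]. *)
Lemma satE (e : seq (prop_in M)) (A : form (esymbol M)) :
  sat e A =
  den (@esym_interp M) (fun i => if onth e i is Some V then sval V else set0) A.
Proof.
elim: A e => [x|i|A IHA B IHB|A IHA|A IHA|A IHA] e //=;
  rewrite ?IHA ?IHB //.
  by case: (onth e i).
apply: funext => v; apply: propext.
have E V : sat (V :: e) A = den (@esym_interp M)
    (scons (sval V) (fun i => if onth e i is Some V then sval V else set0)) A.
  by rewrite IHA; congr den; apply: funext => -[|i].
by split=> H V; move: (H V); rewrite E.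
Qed.

Section Lemmas.
Variable S : Type.
Implicit Types (A : form S) (s : S -> set (world M)) (r : nat -> set (world M)).

Lemma den_lift_at k s r A :
  den s r (lift_at k A) = den s (fun i => r (if i < k then i else i.+1)) A.
Proof.
elim: A k r => [x|i|A IHA B IHB|A IHA|A IHA|A IHA] k r //=;
  rewrite ?IHA ?IHB //.
apply: eq_set => v; apply: eq_forall => V.
rewrite IHA; congr (den _ _ _ _); apply: funext => -[|i] //=.
by rewrite ltnS; case: ifP.
Qed.

Lemma den_lift s r V A : den s (scons V r) (lift_form A) = den s r A.
Proof. by rewrite /lift_form den_lift_at. Qed.

Lemma den_subst_at k s r C A :
  den s r (subst_at k C A) =
  den s (fun i => if i < k then r i else if i == k then den s r C else r i.-1) A.
Proof.
elim: A k r C => [x|i|A IHA B IHB|A IHA|A IHA|A IHA] k r C //=;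
  rewrite ?IHA ?IHB //.
  by case: ifP => //; case: ifP.
apply: eq_set => v; apply: eq_forall => V.
rewrite IHA den_lift; congr (den _ _ _ _); apply: funext => -[|i] //=.
rewrite ltnS eqSS; case: ltngtP => //; by case: i.
Qed.

Lemma den_inst s r C A : den s r (inst_form A C) = den s (scons (den s r C) r) A.
Proof.
by rewrite /inst_form den_subst_at; congr den; apply: funext => -[|i].
Qed.

Lemma den_closed k s r r' A :
  closed_at k A -> (forall i, i < k -> r i = r' i) -> den s r A = den s r' A.
Proof.
elim: A k r r' => [x|i|A IHA B IHB|A IHA|A IHA|A IHA] k r r' //= hA hr.
- exact: hr.
- by case/andP: hA => hA hB; rewrite (IHA k _ r') ?(IHB k _ r').
- by rewrite (IHA k _ r').
- by rewrite (IHA k _ r').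
- apply: eq_set => v; apply: eq_forall => V.
  by rewrite (IHA k.+1 _ (scons (sval V) r')) // => -[|i] //= /hr.
Qed.

(** The impredicative reading is kept: the diamond axioms follow from it by a choice of [V], without
    producing an accessible world. *)
Lemma den_Dia s r A v :
  den s r (Dia A) v <->
  forall V : prop_in M,
    (forall w, acc v w -> den s r A w -> forall u, acc u w -> sval V u) ->
    sval V v.
Proof.
by split=> H V; move: (H V); rewrite -(den_lift s r (sval V) A).
Qed.

Lemma den_BDia s r A v :
  den s r (BDia A) v <->
  forall V : prop_in M,
    (forall w, acc w v -> den s r A w -> forall u, acc w u -> sval V u) ->
    sval V v.
Proof.
by split=> H V; move: (H V); rewrite -(den_lift s r (sval V) A).
Qed.

End Lemmas.

Lemma den_map (S T : Type) (f : S -> T) s r (A : form S) :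
  den s r (map_form f A) = den (fun x => s (f x)) r A.
Proof.
elim: A r => [x|i|A IHA B IHB|A IHA|A IHA|A IHA] r //=; rewrite ?IHA ?IHB //.
by apply: eq_set => v; apply: eq_forall => V; rewrite IHA.
Qed.

Lemma den_psubst (S T : Type) (s : T -> set (world M)) r
    (a : S -> form T) b (A : form S) :
  den s r (psubst a b A) =
  den (fun x => den s r (a x)) (fun i => den s r (b i)) A.
Proof.
elim: A r a b => [x|i|A IHA B IHB|A IHA|A IHA|A IHA] r a b //=;
  rewrite ?IHA ?IHB //.
apply: eq_set => v; apply: eq_forall => V.
rewrite IHA; congr (den _ _ _ _); first by apply: funext => x; rewrite den_lift.
by apply: funext => -[|i] //=; rewrite den_lift.
Qed.

Lemma den_fresh P V s r A : fresh_in P A ->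
  den (fun Q => if Q == P then V else s Q) r A = den s r A.
Proof.
elim: A r => [Q|i|A IHA B IHB|A IHA|A IHA|A IHA] r //=.
- by case: eqP.
- by case/andP=> /IHA -> /IHB ->.
- by move=> /IHA ->.
- by move=> /IHA ->.
- by move=> /IHA {}IHA; apply: eq_set => v; apply: eq_forall => U; rewrite IHA.
Qed.

End Denotation.

(** * Comprehension with parameters, and soundness *)

Lemma den_props (M : relational_model) (S : Type) (s : S -> set (world M)) r A :
  (forall x, props (s x)) -> (forall i, props (r i)) -> props (den s r A).
Proof.
move=> hs hr.
(* Admissible parameters become symbols of the expanded language, which makes the formula closed. *)
pose a x : form (esymbol M) := Sym (inr (exist _ (s x) (hs x))).
pose b i : form (esymbol M) := Sym (inr (exist _ (r i) (hr i))).
have := @model_comprehensive M (psubst a b A).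
rewrite /satisfies satE den_psubst /=; apply.
by apply: closed_psubst.
Qed.

(** All admissible interpretations [s] of the symbols are covered, because the generalisation rule
    reinterprets its fresh symbol by an arbitrary admissible set. *)
Lemma soundness (M : relational_model) A : Kt2 A ->
  forall (s r : nat -> set (world M)) v,
  (forall x, props (s x)) -> (forall i, props (r i)) -> den s r A v.
Proof.
elim=> {A} [_ [B _ <-]|A B|A B C|A C|A B|A B|A B|A B|A B|A|A|A|A|A B _ IH1 _ IH2
  |A P fP _ IH|A _ IH|A _ IH] s r v hs hr.
- move=> /= HB; have [//|nB] := pselect (den s r B v).
  (* [Bot] puts [v] in every admissible set, in particular in the denotation of [B]. *)
  by have := HB (fun b => False_ind _ (nB b))
    (exist _ _ (den_props B hs hr)).
- by move=> a b.
- by move=> abc ab a; apply: abc => //; apply: ab.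
- by move=> /= H; rewrite den_inst; apply: (H (exist _ _ (den_props C hs hr))).
- by move=> /= H a V; apply: H; rewrite den_lift.
- by move=> /= H1 H2 w vw; apply: H1 => //; apply: H2.
- move=> H1 /den_Dia H2; apply/den_Dia => V HV; apply: H2 => w vw aw.
  by apply: HV => //; apply: H1.
- by move=> /= H1 H2 w vw; apply: H1 => //; apply: H2.
- move=> H1 /den_BDia H2; apply/den_BDia => V HV; apply: H2 => w vw aw.
  by apply: HV => //; apply: H1.
- by move=> /den_BDia /(_ (exist _ _ (den_props A hs hr))); apply => w _ /=; apply.
- by move=> av w vw; apply/den_BDia => V; apply; first exact: vw.
- by move=> /den_Dia /(_ (exist _ _ (den_props A hs hr))); apply => w _ /=; apply.
- by move=> av w vw; apply/den_Dia => V; apply; first exact: vw.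
- by apply: (IH1 s r v hs hr); apply: IH2.
- move=> V; rewrite -(den_fresh (sval V) _ _ fP).
  have := IH (fun Q => if Q == P then sval V else s Q) r v.
  rewrite den_inst /= eqxx; apply=> // x; case: ifP => // _; exact: svalP.
- by move=> w _; apply: IH.
- by move=> w _; apply: IH.
Qed.

(** * Theories *)

(** Closure under generalisation and necessitation is left out, since adding a hypothesis need not
    preserve it. *)
Definition theory (D : set formula) : Prop :=
  Kt2 `<=` D /\ forall A B, D (A ~> B) -> D A -> D B.

(** The deduction theorem holds by definition, so [change] introduces a hypothesis. *)
Definition ext (D : set formula) (A : formula) : set formula :=
  [set B | D (A ~> B)].

Lemma Kt2_theory : theory Kt2.
Proof. by split=> // A B; apply: rule_mp. Qed.

Section Theory.
Variable D : set formula.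
Hypothesis thD : theory D.

Lemma theory_mp A B : D (A ~> B) -> D A -> D B. Proof. exact: thD.2. Qed.

Lemma theory_weaken A B : D B -> D (A ~> B).
Proof. by apply: theory_mp; apply: thD.1; apply: ax_K. Qed.

Lemma theory_id A : D (A ~> A).
Proof.
have := thD.1 _ (ax_S _ A (A ~> A) A) => /theory_mp H.
by apply: (theory_mp (H _)); apply: thD.1; apply: ax_K.
Qed.

Lemma ext_theory A : theory (ext D A).
Proof.
split=> [B /thD.1|B C]; first exact: theory_weaken.
by move=> /(theory_mp (thD.1 _ (ax_S _ _ _ _))); apply: theory_mp.
Qed.

Lemma theory_exfalso A : D Bot -> D A.
Proof. by apply: theory_mp; apply: thD.1 _ (ax_comprehension _ (Var 0) A). Qed.

Lemma theory_dne A : D (Neg (Neg A)) -> D A.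
Proof. by apply: theory_mp; apply: thD.1; apply: ax_extra; exists A. Qed.

End Theory.

Lemma theory_cases D A B : theory D -> D (A ~> B) -> D (Neg A ~> B) -> D B.
Proof.
move=> thD dA dnA; apply: theory_dne => //.
change (ext D (Neg B) Bot); have thE := ext_theory thD (Neg B).
have nB : ext D (Neg B) (Neg B) by apply: theory_id.
apply: (theory_mp thE nB); apply: (theory_mp thE (theory_weaken thD _ dnA)).
change (ext (ext D (Neg B)) A Bot); have thF := ext_theory thE A.
apply: (theory_mp thF (theory_weaken thE _ nB)).
exact: (theory_weaken thD _ dA).
Qed.

Lemma theory_absurd D A B : theory D -> D (Neg A) -> D A -> D B.
Proof. by move=> thD nA a; apply: theory_exfalso => //; apply: (theory_mp thD nA). Qed.

Lemma Kt2_trans A B C : Kt2 (A ~> B) -> Kt2 (B ~> C) -> Kt2 (A ~> C).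
Proof.
move=> ab bc; have th := ext_theory Kt2_theory A.
exact: (theory_mp th (theory_weaken Kt2_theory _ bc)).
Qed.

(** * Fresh symbols, the omega rule and the Barcan formulas *)

Fixpoint sym_bound (A : formula) : nat :=
  match A with
  | Sym P => P.+1
  | Var _ => 0
  | Imp A B => maxn (sym_bound A) (sym_bound B)
  | Box A | BBox A | All A => sym_bound A
  end.

Lemma fresh_sym_bound P A : sym_bound A <= P -> fresh_in P A.
Proof.
elim: A => [Q|i|A IHA B IHB|A IHA|A IHA|A IHA] //=; first by move/ltn_eqF ->.
by rewrite geq_max => /andP[/IHA -> /IHB ->].
Qed.

Lemma fresh_lift P k A : fresh_in P (lift_at k A) = fresh_in P A.
Proof.
by elim: A k => [Q|i|A IHA B IHB|A IHA|A IHA|A IHA] k //=; rewrite ?IHA ?IHB.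
Qed.

(** The premise [C] lets the rule be applied inside [ext D C]. *)
Definition omega (D : set formula) : Prop :=
  forall C E, (forall P, D (C ~> inst_form E (Sym P))) -> D (C ~> All E).

(** A single premise suffices: the one at a symbol fresh for both [C] and [E], to which
    generalisation applies. *)
Lemma Kt2_omega : omega Kt2.
Proof.
move=> C E H.
apply: rule_mp (ax_all_imp _ C E) _.
apply: (@rule_gen _ _ (maxn (sym_bound C) (sym_bound E))) => /=.
  by rewrite fresh_lift !fresh_sym_bound ?leq_maxl ?leq_maxr.
by rewrite /inst_form /= subst_at_lift_at; apply: H.
Qed.

(** The boolean selects the direction of time, [true] being forward. *)
Definition bx (b : bool) (A : formula) : formula := if b then Box A else BBox A.
Definition dm (b : bool) (A : formula) : formula := if b then Dia A else BDia A.

Lemma bx_nec b A : Kt2 A -> Kt2 (bx b A).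
Proof. by case: b; [apply: rule_nec_box|apply: rule_nec_bbox]. Qed.

Lemma bx_K b A B : Kt2 (bx b (A ~> B) ~> bx b A ~> bx b B).
Proof. by case: b; [apply: ax_box_box|apply: ax_bbox_bbox]. Qed.

Lemma bx_dm b A B : Kt2 (bx b (A ~> B) ~> dm b A ~> dm b B).
Proof. by case: b; [apply: ax_box_dia|apply: ax_bbox_bdia]. Qed.

Lemma dm_bx b A : Kt2 (dm b (bx (~~ b) A) ~> A).
Proof. by case: b; [apply: ax_dia_bbox|apply: ax_bdia_box]. Qed.

Lemma bx_conv_dm b A : Kt2 (A ~> bx b (dm (~~ b) A)).
Proof. by case: b; [apply: ax_box_bdia|apply: ax_bbox_dia]. Qed.

Lemma bx_mono b A B : Kt2 (A ~> B) -> Kt2 (bx b A ~> bx b B).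
Proof. by move=> /(bx_nec b); apply: rule_mp (bx_K _ _ _). Qed.

Lemma inst_bx b E C : inst_form (bx b E) C = bx b (inst_form E C).
Proof. by case: b. Qed.

(** By adjunction it is enough to derive [All E] from [dm (~~ b) (All (bx b E))]. Each instance
    comes from instantiating under the diamond and cancelling it against the box. *)
Lemma barcan b E : Kt2 (All (bx b E) ~> bx b (All E)).
Proof.
apply: Kt2_trans (bx_conv_dm b _) _; apply: bx_mono; apply: Kt2_omega => P.
apply: Kt2_trans (dm_bx _ _).
apply: rule_mp (bx_dm _ _ _) _; apply: bx_nec; rewrite negbK -inst_bx.
exact: ax_comprehension.
Qed.

(** * Saturated worlds *)

(** The last clause is the Henkin property in contrapositive form, with the original symbols as
    witnesses. *)
Definition saturated (w : set formula) : Prop :=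
  [/\ theory w, ~ w Bot, forall B, w B \/ w (Neg B)
    & forall E, (forall P, w (inst_form E (Sym P))) -> w (All E)].

Fixpoint tree_of_form (A : formula) : GenTree.tree nat :=
  match A with
  | Sym P => GenTree.Node 0 [:: GenTree.Leaf P]
  | Var i => GenTree.Node 1 [:: GenTree.Leaf i]
  | Imp A B => GenTree.Node 2 [:: tree_of_form A; tree_of_form B]
  | Box A => GenTree.Node 3 [:: tree_of_form A]
  | BBox A => GenTree.Node 4 [:: tree_of_form A]
  | All A => GenTree.Node 5 [:: tree_of_form A]
  end.

Lemma tree_of_form_inj : injective tree_of_form.
Proof.
elim=> [P|i|A IHA B IHB|A IHA|A IHA|A IHA] [Q|j|A' B'|A'|A'|A'] //=.
- by case=> ->.
- by case=> ->.
- by case=> /IHA -> /IHB ->.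
- by case=> /IHA ->.
- by case=> /IHA ->.
- by case=> /IHA ->.
Qed.

Lemma formula_enum : exists f : nat -> formula, forall A, exists n, f n = A.
Proof.
have /choice [f Hf] : forall n, exists A : formula,
    forall B, pickle (tree_of_form B) = n -> A = B.
  move=> n; have [[A <-]|nA] := pselect (exists A, pickle (tree_of_form A) = n).
    by exists A => B /(pcan_inj pickleK) /tree_of_form_inj.
  (* Default value at numbers that encode no formula. *)
  by exists Bot => B BA; case: nA; exists B.
by exists f => A; exists (pickle (tree_of_form A)); apply: Hf.
Qed.

(** * Extension of a theory with the omega rule to a saturated world *)

Section Lindenbaum.
Variable D : set formula.
Hypotheses (thD : theory D) (omegaD : omega D).

(** A goal [G = C1 ~> ... ~> Cn ~> F] outside [D] stands for the hypotheses
    [C1, ..., Cn] accepted so far, and [D (Neg B ~> G)] means that [B] follows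
    from them. *)
Definition decides (B G : formula) : Prop :=
  D (Neg B ~> G) \/
  D (B ~> G) /\ forall E, B = All E -> exists P, D (inst_form E (Sym P) ~> G).

Lemma absurd_goal A G : D (Neg A ~> A ~> G) /\ D (A ~> Neg A ~> G).
Proof.
split.
- have th1 := ext_theory thD (Neg A); have th2 := ext_theory th1 A.
  change (ext (ext D (Neg A)) A G); apply: (@theory_absurd _ A) => //.
  + by apply: (theory_weaken th1); apply: theory_id.
  + exact: theory_id.
- have th1 := ext_theory thD A; have th2 := ext_theory th1 (Neg A).
  change (ext (ext D A) (Neg A) G); apply: (@theory_absurd _ A) => //.
  + exact: theory_id.
  + by apply: (theory_weaken th1); apply: theory_id.
Qed.

(** Under [Neg G] no instance of [E] can fail, so the omega rule yields [All E] and with it [G]. *)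
Lemma witness_goal E G :
  D (All E ~> G) -> (forall P, D (Neg (inst_form E (Sym P)) ~> G)) -> D G.
Proof.
move=> dE dP; apply: (@theory_cases _ G) => //; first exact: theory_id.
have th1 := ext_theory thD (Neg G).
apply: (theory_mp th1 (theory_weaken thD _ dE)); apply: omegaD => P.
apply: (@theory_cases _ (inst_form E (Sym P)) _ th1); first exact: theory_id.
have th2 := ext_theory th1 (Neg (inst_form E (Sym P))).
apply: (@theory_absurd _ G _ th2).
  by apply: (theory_weaken th1); apply: theory_id.
exact: (theory_weaken thD).
Qed.

(** [B] is accepted unless it leads to [G]. If it does and is some [All E], the negation of an
    instance of [E] is accepted instead, and [witness_goal] provides the symbol. *)
Lemma decide_step B G : ~ D G ->
  exists G', [/\ ~ D G', D (G ~> G') & decides B G'].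
Proof.
move=> nG; have [BG|nBG] := pselect (D (B ~> G)); last first.
  exists (B ~> G); split=> //; first by apply: thD.1; apply: ax_K.
  by left; apply: (absurd_goal B G).1.
have [[E BE]|nE] := pselect (exists E, B = All E); last first.
  exists G; split=> //; first exact: theory_id.
  by right; split=> // E BE; case: nE; exists E.
rewrite {}BE in BG *.
have [H|] := pselect (forall P, D (Neg (inst_form E (Sym P)) ~> G)).
  by case: nG; apply: witness_goal H.
move=> /existsNP[P nP]; exists (Neg (inst_form E (Sym P)) ~> G); split=> //.
  by apply: thD.1; apply: ax_K.
right; split.
  apply: (theory_mp (ext_theory thD (All E))) BG; apply: (theory_weaken thD).
  by apply: thD.1; apply: ax_K.
by move=> _ [<-]; exists P; apply: (absurd_goal _ _).2.
Qed.

Lemma lindenbaum F : ~ D F -> exists w, [/\ saturated w, D `<=` w & ~ w F].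
Proof.
move=> nF; have [f Hf] := formula_enum.
have /choice [next Hnext] : forall p : formula * formula, exists G',
    ~ D p.2 -> [/\ ~ D G', D (p.2 ~> G') & decides p.1 G'].
  move=> [B G]; have [DG|/(decide_step B)[G' HG']] := pselect (D G).
    by exists Bot.
  by exists G'.
pose fix g n := if n is m.+1 then next (f m, g m) else F.
have gD n : ~ D (g n).
  by elim: n => [//|n IH] /=; case: (Hnext (f n, g n) IH).
have gS n : [/\ ~ D (g n.+1), D (g n ~> g n.+1) & decides (f n) (g n.+1)].
  exact: Hnext (f n, g n) (gD n).
have trans A B C : D (A ~> B) -> D (B ~> C) -> D (A ~> C).
  move=> ab bc; apply: (theory_mp (ext_theory thD A)) ab.
  exact: (theory_weaken thD _ bc).
have gle m n : m <= n -> D (g m ~> g n).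
  elim: n => [|n IH]; first by rewrite leqn0 => /eqP ->; apply: theory_id.
  rewrite leq_eqVlt => /orP[/eqP ->|]; first exact: theory_id.
  by rewrite ltnS => /IH /trans; apply; case: (gS n).
(* The stages increase, as each goal implies the next; finitely many members can thus be moved to a
   common stage. *)
pose w : set formula := [set B | exists n, D (Neg B ~> g n)].
have wle m n B : m <= n -> D (Neg B ~> g m) -> D (Neg B ~> g n).
  by move=> /gle mn /trans; apply.
have Dw : D `<=` w.
  move=> B DB; exists 0.
  exact: (theory_mp thD (absurd_goal B _).2).
have thw : theory w.
  split=> [B /thD.1/Dw//|A B [m Hm] [n Hn]].
  exists (maxn m n).
  have {}Hm := wle _ _ _ (leq_maxl m n) Hm.
  have {}Hn := wle _ _ _ (leq_maxr m n) Hn.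
  have th1 := ext_theory thD (Neg B); have th2 := ext_theory th1 A.
  apply: (@theory_cases _ A _ th1); last exact: (theory_weaken thD).
  apply: (@theory_cases _ (A ~> B) _ th2); last first.
    by apply: (theory_weaken th1); apply: (theory_weaken thD).
  have th3 := ext_theory th2 (A ~> B); apply: (@theory_absurd _ B _ th3).
    apply: (theory_weaken th2); apply: (theory_weaken th1); exact: theory_id.
  apply: (theory_mp th3 (theory_id th2 _)).
  apply: (theory_weaken th2); exact: theory_id.
have wF : ~ w F.
  (* Since [g 0] is [F], both [F] and [Neg F] would lead to [g n]. *)
  by move=> [n Hn]; apply: (gD n); apply: theory_cases (gle 0 n isT) Hn.
exists w; split=> //; split=> //.
- by move=> /(theory_exfalso thw F).
- move=> B; have [n <-] := Hf B; case: (gS n) => _ _ [H|[H _]].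
    by left; exists n.+1.
  right; exists n.+1; apply: trans _ H.
  by apply: thD.1; apply: ax_extra; exists (f n).
- move=> E HE; have [n En] := Hf (All E).
  case: (gS n) => nG _; rewrite En => -[H|[_ /(_ E erefl)[P HP]]].
    by exists n.+1.
  (* If [All E] was rejected with witness [P], that instance and its negation both lead to the goal
     at a common stage. *)
  have [m Hm] := HE P; case: (gD (maxn m n.+1)).
  apply: (theory_cases thD) (wle _ _ _ (leq_maxl _ _) Hm).
  by apply: trans HP _; apply: gle; apply: leq_maxr.
Qed.

End Lindenbaum.

Lemma bx_theory b w : saturated w -> theory [set B | w (bx b B)].
Proof.
case=> thw _ _ _; split=> [B HB|A B /= AB].
  by apply: thw.1; apply: bx_nec.
by apply: theory_mp => //; apply: (theory_mp thw (thw.1 _ (bx_K _ _ _))).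
Qed.

(** The Henkin property of [w] collects the boxed instances under a quantifier, and [barcan] moves
    the box outside. *)
Lemma bx_omega b w : saturated w -> omega [set B | w (bx b B)].
Proof.
case=> thw _ _ henkin C E H /=.
apply: (theory_mp thw (thw.1 _ (bx_mono b (ax_all_imp _ C E)))).
apply: (theory_mp thw (thw.1 _ (barcan b _))); apply: henkin => P.
by rewrite inst_bx /inst_form /= subst_at_lift_at; apply: H.
Qed.

(** Lets one relation serve both boxes. Were [Neg B] in [w], then [dm (~~ b) (Neg B)] would be in
    [w'], against [bx (~~ b) B]. *)
Lemma bx_converse b w w' : saturated w -> saturated w' ->
  (forall B, w (bx b B) -> w' B) -> forall B, w' (bx (~~ b) B) -> w B.
Proof.
move=> [thw _ maxw _] [thw' botw' _ _] H B HB; case: (maxw B) => // nB.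
case: botw'.
have {}nB : w' (dm (~~ b) (Neg B)).
  by apply: H; apply: (theory_mp thw (thw.1 _ (bx_conv_dm _ _))).
(* The contradiction is drawn as [bx b Bot] under the diamond, which [dm_bx] cancels to [Bot]. *)
apply: (theory_mp thw' (thw'.1 _ (dm_bx (~~ b) _))); rewrite negbK.
apply: (theory_mp thw') nB; apply: (theory_mp thw' (thw'.1 _ (bx_dm _ _ _))).
apply: (theory_mp thw') HB; apply: thw'.1; apply: bx_mono.
exact: (absurd_goal Kt2_theory B _).2.
Qed.

(** * The canonical model *)

Definition saturated_world : Type := {w : set formula | saturated w}.

Definition holds (C : formula) : set saturated_world := [set w | sval w C].

Definition canonical_props : set (set saturated_world) := range holds.

Lemma canonical_symbol_props P : canonical_props (holds (Sym P)).
Proof. by exists (Sym P). Qed.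

Definition canonical_structure : relational_structure :=
  @RelationalStructure saturated_world canonical_props (fun P => holds (Sym P))
    canonical_symbol_props (fun w w' => forall B, sval w (Box B) -> sval w' B).

Lemma bx_witness b (w : saturated_world) B : ~ sval w (bx b B) ->
  exists2 w' : saturated_world,
    (forall C, sval w (bx b C) -> sval w' C) & ~ sval w' B.
Proof.
case: w => w satw /= nB.
have [w' [satw' sub nB']] :=
  lindenbaum (bx_theory b satw) (@bx_omega b w satw) nB.
by exists (exist _ w' satw').
Qed.

(** Admissible sets are named by formulas kept in [r], so the induction is on [A] before
    substitution and the complexity of instances does no harm. General [S] and [s] cover the
    expanded language. *)
Lemma truth (S : Type) (s : S -> formula) (r : nat -> formula) A :
  @den canonical_structure S (fun x => holds (s x)) (fun i => holds (r i)) A =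
  holds (psubst s r A).
Proof.
elim: A s r => [x|i|A IHA B IHB|A IHA|A IHA|A IHA] s r //=.
- rewrite IHA IHB; apply: eq_set => -[w satw] /=; rewrite /holds /=.
  have [thw _ maxw _] := satw; apply: propext; split=> [H|]; last exact: theory_mp.
  case: (maxw (psubst s r A)) => [/H|nA]; first exact: theory_weaken.
  by apply: (theory_mp thw) nA; apply: thw.1; apply: (absurd_goal Kt2_theory _ _).1.
- rewrite IHA; apply: eq_set => w; apply: propext; split=> [H|H w']; last exact.
  by apply: contrapT => /(@bx_witness true)[w' /H].
(* Accessibility is defined through [Box], so [bx_converse] translates it in both directions. *)
- rewrite IHA; apply: eq_set => w; apply: propext; split=> [H|H w'] /=.
    apply: contrapT => /(@bx_witness false)[w' ww']; apply; apply: H.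
    exact: (@bx_converse false _ _ (svalP w) (svalP w')).
  by move=> w'w; apply: (@bx_converse true _ _ (svalP w') (svalP w) w'w).
- apply: eq_set => w; apply: propext.
  have E C : @den canonical_structure S (fun x => holds (s x))
      (scons (holds C) (fun i => holds (r i))) A = holds (psubst s (scons C r) A).
    by rewrite -IHA; congr den; apply: funext => -[].
  have [thw _ _ henkin] := svalP w; split=> [H|H [V [C _ CV]]] /=.
    (* Symbols alone suffice in this direction; the other one instantiates at an arbitrary formula
       [C]. *)
    apply: henkin => P; rewrite inst_psubst.
    by have := H (exist _ _ (canonical_symbol_props P)); rewrite /= E.
  rewrite -CV E /holds /= -inst_psubst.
  by apply: (theory_mp thw) H; apply: thw.1; apply: ax_comprehension.
Qed.

Lemma canonical_comprehensive : comprehensive canonical_structure.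
Proof.
move=> C _.
have /choice [s Hs] : forall x : esymbol canonical_structure,
    exists B, esym_interp x = holds B.
  by case=> [P|[V [B ? BV]]]; [exists (Sym P)|exists B].
(* [Bot] lies in no saturated world, which matches the default [set0] of [satE]. *)
exists (psubst s (fun=> Bot) C) => //; rewrite -truth; apply: funext => w.
rewrite /mkset /satisfies satE.
congr (den _ _ _ _); apply: funext; first by move=> x; rewrite Hs.
suff -> : holds Bot = set0 by case.
by rewrite -subset0 => u; case: (svalP u).
Qed.

Definition canonical_model : relational_model :=
  RelationalModel canonical_comprehensive.

Theorem theoremB (A : formula) (hA : closed_form A) :
  Kt2 A <-> (forall M : relational_model, valid_in M A).
Proof.
split=> [KA M v|valA].
  rewrite /satisfies satE den_map /=.
  (* [soundness] asks for an admissible environment, and the interpretation of any symbol provides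
     one. *)
  rewrite (@den_closed _ _ 0 _ _ (fun=> symbol_interp M 0)) //.
  by apply: soundness => // *; apply: symbol_interp_props.
apply: contrapT => /(lindenbaum Kt2_theory Kt2_omega)[w [satw _ wA]].
apply: wA; have := valA canonical_model (exist _ w satw).
rewrite /satisfies satE den_map /=.
rewrite (@den_closed canonical_structure _ 0 _ _ (fun=> holds Bot)) //.
rewrite (truth (@Sym nat) (fun=> Bot)) /holds /=.
by rewrite (@psubst_closed _ 0).
Qed.
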